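(* Suppose the reinforcement scheme is of Pólya type, that is, $R=mI$, and assumptions (A1) and (A2) given in the context hold. Then there exists a finite random variable $Z^\infty$ such that, as $t\to\infty$, $$Z^t\xrightarrow{a.s.}Z^\infty\mathbf 1.$$
   Context: Graph. $G=(V,E)$ is a finite directed graph with $V=\{1,\dots,N\}$, $E\subseteq V\times V$, no isolated vertices, and adjacency matrix $A$ ($A_{i,j}=1$ if $(i,j)\in E$, else $0$). Let $V(i)=\{j\in V:(j,i)\in E\}$. $G$ is $d$-regular if every vertex has in-degree and out-degree equal to $d$. Urn process (Pólya type, $R=mI$). Fix a positive integer $m$. At each vertex $i$ there is an urn with $W_i^t$ white and $B_i^t$ black balls at time $t\ge0$; the initial configuration is fixed. Let $T_i^t=W_i^t+B_i^t$, $Z_i^t=W_i^t/T_i^t$, $Z^t=(Z_1^t,\dots,Z_N^t)$ and $\mathcal F_t=\sigma(Z^0,\dots,Z^t)$. At time $t+1$ a ball is drawn uniformly at random from every urn (and put back); $Y_i^{t+1}$ is the indicator that the ball drawn from urn $i$ is white. Conditionally on $\mathcal F_t$, the $Y_i^{t+1}$, $i\in V$, are independent with $P(Y_i^{t+1}=1\mid\mathcal F_t)=Z_i^t$. Then $$W_i^{t+1}=W_i^t+m\sum_{j\in V(i)}Y_j^{t+1},\qquad B_i^{t+1}=B_i^t+m\sum_{j\in V(i)}(1-Y_j^{t+1}).$$ Assumptions. (A1) The graph is $d$-regular and the scaled adjacency matrix $\tilde A=\frac1dA$ is diagonalisable, i.e. there is an invertible matrix $P$ with $\tilde A=P\Lambda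 P^{-1}$ for a diagonal matrix $\Lambda$, and $\lambda_{\max}(\tilde A)=1$. (A2) The initial number of balls in each urn is the same: $T_i^0=T^0$ for all $i$, for some $T^0\ge1$. Notation. $\mathbf 1$ is the all-ones row vector of length $N$; $\lambda_{\max}(M)$ is the maximum of the real parts of the eigenvalues of $M$.
   Formalization: The graph is additionally assumed connected (ignoring edge orientations); without this the claim fails, e.g. for two disjoint cycles, with all urns of one starting all white and all urns of the other all black. *)

(* Defs.v *)
From HB Require Import structures.
From mathcomp Require Import all_boot all_order all_algebra.
From mathcomp Require Import all_classical all_reals all_analysis.
From mathcomp Require Export complex.

Set Implicit Arguments.
Unset Strict Implicit.
Unset Printing Implicit Defensive.

Import Order.TTheory GRing.Theory Num.Theory.
Import numFieldNormedType.Exports.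

Local Open Scope classical_set_scope.
Local Open Scope ring_scope.

Section Graph.
Variable N : nat.
(* The vertex set {1, ..., N} is 'I_N; [E i j] means that (i, j) is an edge. *)
Variable E : rel 'I_N.

Definition in_nbrs (i : 'I_N) : {set 'I_N} := [set j | E j i].

Definition out_nbrs (i : 'I_N) : {set 'I_N} := [set j | E i j].

Definition no_isolated_vertex : Prop := forall i, exists j, E i j || E j i.

Definition regular (d : nat) : Prop :=
  forall i, #|in_nbrs i| = d /\ #|out_nbrs i| = d.

(* Paths ignore edge orientations.  On a disconnected graph the urns of two
   components evolve separately and need not have the same limit. *)
Definition weakly_connected : Prop :=
  forall i j, connect (fun u v => E u v || E v u) i j.

Definition adj_mx (K : pzRingType) : 'M[K]_N := \matrix_(i, j) (E i j)%:R.

Definition scaled_adj_mx (K : fieldType) (d : nat) : 'M[K]_N :=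
  d%:R^-1 *: adj_mx K.

End Graph.

Definition is_lambda_max (R : realType) (N : nat) (M : 'M[complex R]_N) (r : R)
    : Prop :=
  (exists2 a, eigenvalue M a & complex.Re a = r) /\
  (forall a, eigenvalue M a -> complex.Re a <= r).

(* Diagonalisability and eigenvalues are over the complex numbers R[i]. *)
Definition assumption_A1 (R : realType) (N : nat) (E : rel 'I_N) (d : nat)
    : Prop :=
  [/\ regular E d,
      diagonalizable (scaled_adj_mx E (complex R) d) &
      is_lambda_max (scaled_adj_mx E (complex R) d) 1].

Definition assumption_A2 (N : nat) (W0 B0 : 'I_N -> nat) (T0 : nat) : Prop :=
  (1 <= T0)%N /\ forall i, (W0 i + B0 i)%N = T0.

Section Conditioning.
Context {d : measure_display} {Omega : measurableType d} {R : realType}.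
Variables (P : probability Omega R) (F : set (set Omega)).

(* [f] is a version of the conditional probability P(A | F). *)
Definition is_cond_prob (A : set Omega) (f : Omega -> R) : Prop :=
  [/\ forall B : set R, measurable B -> F (f @^-1` B),
      P.-integrable setT (EFin \o f) &
      forall D, F D -> (\int[P]_(w in D) (f w)%:E = P (D `&` A))%E].

(* Taking some of the B i equal to setT yields the product rule for every
   subfamily. *)
Definition cond_independent {d' : measure_display} {S : measurableType d'}
    (I : finType) (X : I -> {RV P >-> S}) : Prop :=
  forall (B : I -> set S) (f : I -> Omega -> R),
    (forall i, measurable (B i)) ->
    (forall i, is_cond_prob (X i @^-1` B i) (f i)) ->
    is_cond_prob (\bigcap_i (X i @^-1` B i)) (fun w => \prod_i f i w).

End Conditioning.

Section Urns.
Context {N : nat} (E : rel 'I_N) (m : nat) (W0 B0 : 'I_N -> nat).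
Context {Omega : Type} (R : realType).
(* [Y t i w] tells whether the ball drawn from urn [i] at time [t] is white;
   [Y 0] is not used. *)
Variable Y : nat -> 'I_N -> Omega -> bool.

Fixpoint white (t : nat) (i : 'I_N) (w : Omega) : nat :=
  if t is s.+1 then
    (white s i w + m * \sum_(j in in_nbrs E i) Y s.+1 j w)%N
  else W0 i.

Fixpoint black (t : nat) (i : 'I_N) (w : Omega) : nat :=
  if t is s.+1 then
    (black s i w + m * \sum_(j in in_nbrs E i) (1 - Y s.+1 j w))%N
  else B0 i.

Definition total_balls (t : nat) (i : 'I_N) (w : Omega) : nat :=
  (white t i w + black t i w)%N.

Definition white_frac (t : nat) (i : 'I_N) (w : Omega) : R :=
  (white t i w)%:R / (total_balls t i w)%:R.

Definition white_frac_vec (t : nat) (w : Omega) : 'rV[R]_N :=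
  \row_i white_frac t i w.

(* sigma(Z^0, ..., Z^t), a vector being measurable iff its entries are. *)
Definition history (t : nat) : set (set Omega) :=
  <<s \bigcup_(s in [set s | (s <= t)%N]) \bigcup_(i in [set: 'I_N])
        preimage_set_system setT (white_frac s i) measurable >>.

End Urns.

(* The law of the draws: given the history up to time t, the draws at time
   t + 1 are independent and white with probability Z_i^t. *)
Definition polya_draws {N : nat} (E : rel 'I_N) (m : nat) (W0 B0 : 'I_N -> nat)
    {d : measure_display} {Omega : measurableType d} {R : realType}
    (P : probability Omega R) (Y : nat -> 'I_N -> {RV P >-> bool}) : Prop :=
  forall t : nat,
    (forall i, is_cond_prob P (history E m W0 B0 R Y t)
       (Y t.+1 i @^-1` [set true]) (white_frac E m W0 B0 R Y t i)) /\
    cond_independent (history E m W0 B0 R Y t) (Y t.+1).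

(* Main.v *)
Require Import Defs.
From HB Require Import structures.
From mathcomp Require Import all_boot all_order all_algebra.
From mathcomp Require Import all_classical all_reals all_analysis.
From mathcomp Require Import ring lra zify.
Import Order.TTheory GRing.Theory Num.Theory.
Import numFieldNormedType.Exports measurable_realfun.
Local Open Scope classical_set_scope.
Local Open Scope ring_scope.

(* Since G is d-regular, T^t = T0 + m d t is deterministic, and with
   a_t = m d / T^(t+1), of order 1 / t,
     Z_i^(t+1) = (1 - a_t) Z_i^t + (a_t / d) \sum_(j -> i) Y_j^(t+1).
   The probabilistic input is E [Z_i^s (Y_j^(t+1) - Z_j^t)] = 0 for s <= t.

   Consensus: expanding the square, regularity of in- and out-degrees gives
     E |Z^(t+1)|^2 <= E |Z^t|^2 - (a_t / d) E Phi(Z^t) + 2 N a_t^2,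
   where Phi is the sum of (Z_i - Z_j)^2 over the edges.  Hence
   \sum_t a_t Phi(Z^t) is finite almost surely; as Z moves by at most a_t per
   step and \sum_t a_t diverges, every edge difference tends to 0, and so do
   all differences by connectedness.

   Convergence: \sum_i Z_i^t has orthogonal increments of size O(1 / t), so its
   increments over the blocks [k^3, (k+1)^3) have summable expected absolute
   values, while its oscillation inside a block is O(1 / k). *)

(** * Deterministic sequences, and the step sizes with their sums over cubic blocks *)

Section Sequences.
Context {R : realType}.
Implicit Types (u v a : R^nat) (tau C K : R).

Lemma bounded_series_cvg u K :
  (forall n, 0 <= u n) -> (forall n, series u n <= K) -> cvgn (series u).
Proof.
move=> u0 uK; apply: nondecreasing_is_cvgn; last first.
  by exists K => _ [n _ <-].
by apply: (@nondecreasing_series _ _ xpredT) => n _ _.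
Qed.

Lemma cvg_series_mulr K u :
  cvgn (series u) -> cvgn (series (fun n => K * u n)).
Proof.
move=> cu; rewrite (_ : series _ = (fun n => K * series u n)).
  exact: is_cvgMr.
by apply/funext => n; rewrite /series/= mulr_sumr.
Qed.

Lemma summable_increments_cvg u :
  cvgn (series (fun n => `|u n.+1 - u n|)) -> cvgn u.
Proof.
move=> cu; have /normed_cvg ct : cvgn [normed series (telescope u)] by [].
rewrite (_ : u = (fun n => u 0%N + series (telescope u) n)); last first.
  by apply/funext => n; rewrite -eq_sum_telescope.
by apply: is_cvgD => //; exact: is_cvg_cst.
Qed.

(** Only tails are compared: the terms before [n0] do not affect convergence. *)
Lemma eventually_le_series_cvg {u v} n0 :
  (forall n, 0 <= u n) -> (forall n, 0 <= v n) ->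
  (forall n, (n0 <= n)%N -> u n <= v n) ->
  cvgn (series v) -> cvgn (series u).
Proof.
move=> u0 v0 uv; rewrite -(is_cvg_series_restrict n0) => cv.
rewrite -(is_cvg_series_restrict n0).
have [K Kv] : has_ubound (range (fun n => \sum_(n0 <= k < n) v k)).
  have [M [_ Mv]] := cvg_seq_bounded cv.
  exists (M + 1) => _ [n _ <-]; apply: le_trans (ler_norm _) _.
  by apply: (Mv (M + 1)) => //; rewrite ltrDl.
apply: nondecreasing_is_cvgn.
  by apply: (@nondecreasing_series _ _ xpredT) => n _ _.
exists K => _ [n _ <-]; apply: (@le_trans _ _ (\sum_(n0 <= k < n) v k)).
  by apply: ler_sum_nat => i /andP[i0 _]; exact: uv.
by apply: Kv; exists n.
Qed.

(* [u ^+ 2] has summable increments, hence a limit, and a positive limit would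
   make [a] itself summable. *)
Lemma slowly_varying_cvg0 u a C :
  (forall n, 0 <= u n) -> (forall n, 0 <= a n) ->
  (forall n, `|u n.+1 - u n| <= C * a n) ->
  cvgn (series (fun n => a n * u n)) -> cvgn (series (fun n => a n ^+ 2)) ->
  ~ cvgn (series a) -> u n @[n --> \oo] --> 0.
Proof.
move=> u0 a0 uC cau ca2 dva.
have csq : cvgn (fun n => u n ^+ 2).
  apply: summable_increments_cvg.
  (* By hypothesis [u n.+1 + u n <= 2 * u n + C * a n], so the increment of the square is at most
     [C * a n * (2 * u n + C * a n)], a combination of the two summable series. *)
  apply: (@series_le_cvg _ _
    (fun n => (2 * C) * (a n * u n) + C ^+ 2 * a n ^+ 2)) => n.
  - exact: normr_ge0.
  - have Ca : 0 <= C * a n by apply: le_trans (uC n).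
    rewrite (_ : _ + _ = 2 * ((C * a n) * u n) + (C * a n) ^+ 2); last by ring.
    by apply: addr_ge0; rewrite ?sqr_ge0// mulr_ge0// mulr_ge0.
  - rewrite [leRHS](_ : _ = (C * a n) * (2 * u n + C * a n)); last by ring.
    rewrite subr_sqr normrM; apply: ler_pM => //.
    rewrite (_ : u n.+1 + u n = 2 * u n + (u n.+1 - u n)); last by ring.
    apply: le_trans (ler_normD _ _) _; apply: lerD => //.
    by rewrite ger0_norm// mulr_ge0.
  - by apply: (is_cvg_seriesD _ _); apply: cvg_series_mulr.
have cu : cvgn u.
  rewrite (_ : u = (fun n => Num.sqrt (u n ^+ 2))); last first.
    by apply/funext => n; rewrite sqrtr_sqr ger0_norm.
  have /cvg_ex[l ul] := csq.
  apply/cvg_ex; exists (Num.sqrt l).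
  apply: (@continuous_cvg _ _ _ _ _ (fun n => u n ^+ 2) (@Num.sqrt R)) ul.
  exact: sqrt_continuous.
have /cvg_ex[/= l ul] := cu.
have l0 : 0 <= l.
  by rewrite -(cvg_lim (@norm_hausdorff _ R) ul); apply: limr_ge => //; exact: nearW.
have [<-//|lN0] := eqVneq l 0; exfalso; apply: dva.
have lp : 0 < l by rewrite lt0r lN0.
have l2 : 0 < l / 2 by rewrite divr_gt0.
have /cvgrPdist_lt/(_ _ l2)[n0 _ hn0] := ul.
apply: (@eventually_le_series_cvg a (fun n => (l / 2)^-1 * (a n * u n)) n0) => //.
- by move=> n; rewrite mulr_ge0// ?mulr_ge0// invr_ge0 ltW.
- move=> n nn0; rewrite ler_pdivlMl// mulrC ler_wpM2l//.
  by have := hn0 n nn0; rewrite /= ltr_norml => /andP[_]; lra.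
- exact: cvg_series_mulr.
Qed.

(** For [tau = T0 / (m d)], the weight [a_t = m d / T^(t+1)] of the overview is [step tau t.+1];
    hence the index shift throughout. *)
Definition step tau t : R := (tau + t%:R)^-1.

Lemma step_gt0 tau t : 0 < tau -> 0 < step tau t.
Proof. by move=> t0; rewrite invr_gt0 ltr_wpDr. Qed.

Lemma stepB tau t : 0 < tau ->
  step tau t - step tau t.+1 = step tau t * step tau t.+1.
Proof.
move=> t0; rewrite /step -natr1; set s := t%:R.
have s0 : 0 <= s by rewrite ler0n.
by field; rewrite !gt_eqF; lra.
Qed.

Lemma step_le tau s t : 0 < tau -> (s <= t)%N -> step tau t <= step tau s.
Proof.
by move=> t0 st; rewrite lef_pV2 ?posrE ?ltr_wpDr// lerD2l ler_nat.
Qed.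

Lemma step_le1 tau t : 0 < tau -> step tau t.+1 <= 1.
Proof.
move=> t0; rewrite invf_le1 ?ltr_wpDr//.
have : 1 <= t.+1%:R :> R by rewrite ler1n.
lra.
Qed.

(** The square is at most the product of two consecutive steps, which [stepB] makes a telescoping
    difference. Sums of squares over any block are thereby bounded by a difference of steps. *)
Lemma step_sqr_le tau t : 0 < tau ->
  step tau t.+1 ^+ 2 <= step tau t - step tau t.+1.
Proof.
move=> t0; rewrite stepB// expr2.
by apply: ler_wpM2r; [exact/ltW/step_gt0|exact: step_le].
Qed.

Lemma sum_step_sqr tau n0 n : 0 < tau -> (n0 <= n)%N ->
  \sum_(n0 <= t < n) step tau t.+1 ^+ 2 <= step tau n0 - step tau n.
Proof.
move=> t0 n0n; rewrite -[leRHS]opprB -telescope_sumr// -sumrN.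
by apply: ler_sum_nat => i _; rewrite opprB step_sqr_le.
Qed.

Lemma series_step_sqr_le tau n : 0 < tau ->
  series (fun t => step tau t.+1 ^+ 2) n <= step tau 0.
Proof.
move=> t0; apply: le_trans (sum_step_sqr _ _ _ t0 (leq0n n)) _.
by rewrite gerBl ltW ?step_gt0.
Qed.

Lemma cvg_series_step_sqr tau : 0 < tau ->
  cvgn (series (fun t => step tau t.+1 ^+ 2)).
Proof.
move=> t0; apply: (@bounded_series_cvg _ (step tau 0)) => n.
  exact: sqr_ge0.
exact: series_step_sqr_le.
Qed.

Lemma dvg_series_step tau : 0 < tau ->
  ~ cvgn (series (fun t => step tau t.+1)).
Proof.
move=> t0 cs; apply: (@dvg_harmonic R).
(* Comparison with the harmonic series: [tau + n + 1 <= (tau + 1) * (n + 1)]. *)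
apply: (@series_le_cvg _ _ (fun t => (tau + 1) * step tau t.+1)) => [n|n|n|].
- by rewrite /= invr_ge0.
- by rewrite mulr_ge0 ?ltW ?step_gt0// addr_gt0.
- rewrite /step ler_pdivlMr ?ltr_wpDr// ler_pdivrMl ?ltr0n//.
  rewrite -natr1; have : 0 <= n%:R :> R by [].
  nra.
- exact: cvg_series_mulr.
Qed.

Lemma cube_bracket t : exists k, (k ^ 3 <= t < k.+1 ^ 3)%N.
Proof.
elim: t => [|t [k /andP[kt tk]]]; first by exists 0%N.
have [tk'|tk'] := ltnP t.+1 (k.+1 ^ 3); first by exists k; rewrite tk' leqW.
exists k.+1; rewrite tk'; apply: leq_trans (_ : (k.+1 ^ 3).+1 <= _)%N.
  by rewrite ltnS.
by rewrite ltn_exp2r.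
Qed.

(* The total variation of [u] over the block [[k ^ 3, (k + 1) ^ 3)] is
   [O(1 / k)], so convergence along the cubes suffices. *)
Lemma cvg_along_cubes u tau C : 0 < tau ->
  (forall t, `|u t.+1 - u t| <= C * step tau t.+1) ->
  cvgn (fun k => u (k ^ 3)%N) -> cvgn u.
Proof.
move=> t0 uC /cvg_ex[l ul].
have C0 : 0 <= C.
  by rewrite -(pmulr_lge0 _ (step_gt0 _ 1 t0)); apply: le_trans (uC 0%N).
have var s n : (s <= n)%N -> `|u n - u s| <= C * ((n - s)%:R * step tau s).
  elim: n => [|n IH]; first by rewrite leqn0 => /eqP->; rewrite subrr normr0 mul0r mulr0.
  rewrite leq_eqVlt => /predU1P[->|]; first by rewrite subrr normr0 subnn mul0r mulr0.
  rewrite ltnS => sn; rewrite subSn// -natr1 mulrDl mulrDr mul1r.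
  rewrite (_ : u n.+1 - u s = (u n - u s) + (u n.+1 - u n)); last by ring.
  apply: le_trans (ler_normD _ _) _; apply: lerD; first exact: IH.
  apply: le_trans (uC n) _; rewrite ler_wpM2l// step_le//.
  by rewrite leqW.
apply/cvg_ex; exists l; apply/cvgrPdist_le => e e0.
have e2 : 0 < e / 2 by rewrite divr_gt0.
have /cvgrPdist_le/(_ _ e2)[k1 _ hk1] := ul.
(* The 7 comes from [(k + 1)^3 - k^3 <= 7 k^2] for [k >= 1]: the variation inside block [k] is at
   most [7 C / k], which is below [e / 2] once [k >= k2]. *)
pose k2 := (Num.truncn (7 * C / (e / 2))).+1.
have hk2 : 7 * C <= (e / 2) * k2%:R.
  by rewrite -ler_pdivrMl// mulrC ltW// truncnS_gt.
(* Beyond this cube the block index [k] strictly exceeds both [k1] and [k2], and is in particular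
   positive. *)
exists ((maxn k1 k2).+1 ^ 3)%N => // t /= kt.
have [k /andP[kle tlt]] := cube_bracket t.
have kk : (maxn k1 k2 < k)%N.
  by rewrite -ltnS -(@ltn_exp2r _ _ 3)//; exact: leq_ltn_trans tlt.
have k1k : (k1 <= k)%N by move: kk; rewrite gtn_max => /andP[/ltnW].
have k2k : (k2 <= k)%N by move: kk; rewrite gtn_max => /andP[_ /ltnW].
have k0 : (0 < k)%N by exact: leq_trans kk.
rewrite (_ : l - u t = (l - u (k ^ 3)%N) - (u t - u (k ^ 3)%N)); last by ring.
apply: le_trans (ler_normB _ _) _; rewrite [e]splitr; apply: lerD.
  exact: hk1.
apply: le_trans (var _ _ kle) _.
have kR : 1 <= k%:R :> R by rewrite ler1n.
have k2R : k2%:R <= k%:R :> R by rewrite ler_nat.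
have d1 : (t - k ^ 3)%:R <= 7 * k%:R ^+ 2 :> R.
  rewrite -natrX -natrM ler_nat.
  have : (t < k ^ 3 + 7 * k ^ 2)%N.
    by apply: leq_trans tlt _; rewrite !expnS !expn0; nia.
  lia.
have d2 : step tau (k ^ 3) <= (k%:R ^+ 3)^-1.
  rewrite /step natrX lef_pV2 ?posrE ?exprn_gt0 ?ltr_wpDr ?exprn_ge0//; first by lra.
  by lra.
have d3 : (t - k ^ 3)%:R * step tau (k ^ 3) <= 7 / k%:R.
  apply: le_trans (ler_pM _ _ d1 d2) _ => //; first by rewrite ltW ?step_gt0.
  rewrite le_eqVlt; apply/orP; left; apply/eqP.
  by field; rewrite gt_eqF//; lra.
apply: (@le_trans _ _ (C * (7 / k%:R))); first by rewrite ler_wpM2l.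
rewrite mulrA ler_pdivrMr; last by lra.
rewrite mulrC in hk2 *; nra.
Qed.

(** The gap is of order [k^-4], so the weight leaves order [k^-2]; the bound is written as a squared
    step so that [series_step_sqr_le] can sum it. *)
Lemma step_cube_gap tau k : 0 < tau ->
  k.+1%:R ^+ 2 * (step tau (k ^ 3) - step tau (k.+1 ^ 3)) <=
  48 * (1 + tau^-1) * step 1 k.+1 ^+ 2.
Proof.
move=> t0; rewrite /step !natrX -natr1.
set x := k%:R; have x0 : 0 <= x by rewrite /x ler0n.
have ti : 0 < tau^-1 by rewrite invr_gt0.
have tti : tau * tau^-1 = 1 by rewrite divff// gt_eqF.
have x3 : 0 <= x ^+ 3 by rewrite exprn_ge0.
have y1 : 1 <= x + 1 by lra.
have y2 : 0 < (x + 1) ^+ 2 by rewrite exprn_gt0//; lra.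
have y3 : 0 < (x + 1) ^+ 3 by rewrite exprn_gt0//; lra.
have -> : (tau + x ^+ 3)^-1 - (tau + (x + 1) ^+ 3)^-1
    = (3 * x ^+ 2 + 3 * x + 1) * ((tau + x ^+ 3)^-1 * (tau + (x + 1) ^+ 3)^-1).
  by field; rewrite !gt_eqF//; lra.
(* The constant combines [(x + 1)^3 <= 4 (1 + x^3)], whose slack is [3 (x - 1)^2 (x + 1)], with
   [1 + x^3 <= (1 + tau^-1) (tau + x^3)]. *)
have p_le : (tau + x ^+ 3)^-1 <= 4 * (1 + tau^-1) / (x + 1) ^+ 3.
  rewrite ler_pdivlMr// mulrC ler_pdivrMr; last lra.
  have h1 : (x + 1) ^+ 3 <= 4 * (1 + x ^+ 3).
    have : 0 <= (x - 1) ^+ 2 * (x + 1) by rewrite mulr_ge0 ?sqr_ge0//; lra.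
    by rewrite -subr_ge0 => h; nra.
  have h2 : 1 + x ^+ 3 <= (1 + tau^-1) * (tau + x ^+ 3).
    have := mulr_ge0 (ltW ti) x3; lra.
  lra.
have q_le : (tau + (x + 1) ^+ 3)^-1 <= ((x + 1) ^+ 3)^-1.
  by rewrite lef_pV2 ?posrE//; lra.
have pq : (tau + x ^+ 3)^-1 * (tau + (x + 1) ^+ 3)^-1 <=
    (4 * (1 + tau^-1) / (x + 1) ^+ 3) * ((x + 1) ^+ 3)^-1.
  by apply: ler_pM => //; rewrite invr_ge0; lra.
have n_le : 3 * x ^+ 2 + 3 * x + 1 <= 3 * (x + 1) ^+ 2 by nra.
(* Here 12 is 3 from [n_le] times 4 from [p_le]; a further 4 gives 48, since [step 1 k.+1] is
   [1 / (x + 2)] and [x + 2 <= 2 (x + 1)]. *)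
apply: (@le_trans _ _ (12 * (1 + tau^-1) / (x + 1) ^+ 2)).
  have n_ge0 : 0 <= 3 * x ^+ 2 + 3 * x + 1 by nra.
  have pq0 : 0 <= (tau + x ^+ 3)^-1 * (tau + (x + 1) ^+ 3)^-1.
    by rewrite mulr_ge0// invr_ge0; lra.
  have := ler_pM n_ge0 pq0 n_le pq; rewrite -(ler_pM2l y2) => /le_trans; apply.
  rewrite le_eqVlt; apply/orP; left; apply/eqP.
  by field; rewrite !gt_eqF//; lra.
rewrite exprVn ler_pdivrMr// mulrAC ler_pdivlMr; last by rewrite exprn_gt0//; lra.
rewrite (_ : 48 * _ * _ = 12 * (1 + tau^-1) * (4 * (x + 1) ^+ 2)); last by ring.
rewrite ler_wpM2l//; last by nra.
by apply: mulr_ge0 => //; lra.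
Qed.

End Sequences.

(** * Means of bounded random variables and almost sure convergence criteria *)

Section BoundedRandomVariables.
Context {d} {T : measurableType d} {R : realType} (P : probability T R).
Implicit Types f g : T -> R.

(** A class closed under sums and products and integrable for a probability, so that integrability
    of every polynomial in the draws and fractions follows from closure. *)
Definition bounded_measurable f :=
  measurable_fun setT f /\ exists C, forall w, `|f w| <= C.

Lemma bounded_measurable_cst c : bounded_measurable (fun=> c).
Proof. by split; [exact: measurable_cst|exists `|c|]. Qed.

Lemma bounded_measurableD f g : bounded_measurable f -> bounded_measurable g ->
  bounded_measurable (fun w => f w + g w).
Proof.
move=> [mf [C fC]] [mg [D gD]]; split; first exact: measurable_funD.
by exists (C + D) => w; apply: le_trans (ler_normD _ _) _; exact: lerD.
Qed.

Lemma bounded_measurableM f g : bounded_measurable f -> bounded_measurable g ->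
  bounded_measurable (fun w => f w * g w).
Proof.
move=> [mf [C fC]] [mg [D gD]]; split; first exact: measurable_funM.
by exists (C * D) => w; rewrite normrM; exact: ler_pM.
Qed.

Lemma bounded_measurableB f g : bounded_measurable f -> bounded_measurable g ->
  bounded_measurable (fun w => f w - g w).
Proof.
move=> [mf [C fC]] [mg [D gD]]; split; first exact: measurable_funB.
by exists (C + D) => w; apply: le_trans (ler_normB _ _) _; exact: lerD.
Qed.

Lemma bounded_measurable_exp f n : bounded_measurable f ->
  bounded_measurable (fun w => f w ^+ n).
Proof.
move=> [mf [C fC]]; split; first exact: measurable_funX.
by exists (C ^+ n) => w; rewrite normrX lerXn2r// nnegrE// (le_trans _ (fC w)).
Qed.

Lemma bounded_measurable_sum I (r : seq I) (Q : pred I) (F : I -> T -> R) :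
  (forall i, bounded_measurable (F i)) ->
  bounded_measurable (fun w => \sum_(i <- r | Q i) F i w).
Proof.
move=> bF; elim: r => [|i r IH].
  by under eq_fun do rewrite big_nil; exact: bounded_measurable_cst.
under eq_fun do rewrite big_cons.
by case: (Q i) => //; exact: bounded_measurableD.
Qed.

Lemma bounded_measurable_integrable f :
  bounded_measurable f -> P.-integrable setT (EFin \o f).
Proof.
move=> [mf [C fC]]; apply: measurable_bounded_integrable => //.
  by rewrite [ltLHS](_ : _ = 1%E) ?ltry//; exact: probability_setT.
exists C; split; first by rewrite num_real.
by move=> x Cx w _; apply: le_trans (fC w) (ltW Cx).
Qed.

Lemma mean_cst c : \int[P]_w (fun=> c) w = c :> R.
Proof.
rewrite Rintegral_cst// [X in fine X](_ : _ = 1%E) ?mulr1//.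
exact: probability_setT.
Qed.

Lemma mean_add f g : bounded_measurable f -> bounded_measurable g ->
  \int[P]_w (f w + g w) = \int[P]_w f w + \int[P]_w g w.
Proof.
by move=> *; rewrite RintegralD//; exact: bounded_measurable_integrable.
Qed.

Lemma mean_sub f g : bounded_measurable f -> bounded_measurable g ->
  \int[P]_w (f w - g w) = \int[P]_w f w - \int[P]_w g w.
Proof.
by move=> *; rewrite RintegralB//; exact: bounded_measurable_integrable.
Qed.

Lemma mean_mull c f : bounded_measurable f ->
  \int[P]_w (c * f w) = c * \int[P]_w f w.
Proof.
by move=> *; rewrite RintegralZl//; exact: bounded_measurable_integrable.
Qed.

Lemma mean_sum I (r : seq I) (Q : pred I) (F : I -> T -> R) :
  (forall i, bounded_measurable (F i)) ->
  \int[P]_w (\sum_(i <- r | Q i) F i w) =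
  \sum_(i <- r | Q i) \int[P]_w F i w.
Proof.
move=> bF; elim: r => [|i r IH].
  by under eq_Rintegral do rewrite big_nil; rewrite big_nil mean_cst.
under eq_Rintegral do rewrite big_cons; rewrite big_cons; case: (Q i) => //.
by rewrite mean_add ?IH//; exact: bounded_measurable_sum.
Qed.

Lemma mean_le f g : bounded_measurable f -> bounded_measurable g ->
  (forall w, f w <= g w) -> \int[P]_w f w <= \int[P]_w g w.
Proof.
by move=> *; apply: le_Rintegral => //; exact: bounded_measurable_integrable.
Qed.

(** By monotone convergence the sum, taken in the extended reals, has integral at most [C]; it is
    therefore almost surely finite and bounds the partial sums. *)
Lemma ae_summable (X : nat -> T -> R) C :
  (forall n w, 0 <= X n w) -> (forall n, bounded_measurable (X n)) ->
  (forall n, \sum_(0 <= k < n) \int[P]_w X k w <= C) ->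
  {ae P, forall w, cvgn (series (X ^~ w))}.
Proof.
move=> X0 bX XC.
pose f w := (\sum_(n <oo) (X n w)%:E)%E.
have mX n : measurable_fun setT (fun w => (X n w)%:E).
  by apply/measurable_EFinP; case: (bX n).
have mf : measurable_fun setT f.
  by apply: ge0_emeasurable_sum => // k w _ _; rewrite lee_fin.
have fi : P.-integrable setT f.
  apply/integrableP; split => //.
  under eq_integral.
    move=> w _; rewrite gee0_abs; last by apply: nneseries_ge0 => *; rewrite lee_fin.
    over.
  rewrite /f integral_nneseries//; last by move=> n w _; rewrite lee_fin.
  apply: (@le_lt_trans _ _ C%:E); last exact: ltry.
  apply: lime_le.
    by apply: is_cvg_nneseries => n _ _; apply: integral_ge0 => w _; rewrite lee_fin.
  apply: nearW => n; rewrite (eq_bigr (fun k => (\int[P]_w X k w)%:E)).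
    by rewrite sumEFin lee_fin.
  move=> k _; rewrite /Rintegral fineK//.
  by apply: integrable_fin_num => //; exact: bounded_measurable_integrable.
have := integrable_ae measurableT fi.
apply: filterS => w /(_ I) fw; apply: (@bounded_series_cvg _ _ (fine (f w))) => // n.
rewrite -lee_fin fineK// -sumEFin.
by apply: nneseries_lim_ge => k _ _; rewrite lee_fin.
Qed.

(* Orthogonality of the increments bounds the variance of a block by the
   decrease of [step], so the blocks delimited by the cubes have summable
   expected absolute values. *)
Lemma orthogonal_increments_ae_cvg (M : nat -> T -> R) tau C :
  0 < tau -> (forall t, bounded_measurable (M t)) ->
  (forall t w, `|M t.+1 w - M t w| <= C * step tau t.+1) ->
  (forall s t, (s <= t)%N ->
    \int[P]_w ((M t w - M s w) * (M t.+1 w - M t w)) = 0) ->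
  {ae P, forall w, cvgn (M ^~ w)}.
Proof.
move=> t0 bM MC orth.
have bB s t : bounded_measurable (fun w => M t w - M s w).
  exact: bounded_measurableB.
have var s t : (s <= t)%N ->
    \int[P]_w ((M t w - M s w) ^+ 2) <= C ^+ 2 * (step tau s - step tau t).
  elim: t => [|t IH].
    rewrite leqn0 => /eqP ->; rewrite subrr mulr0.
    under eq_Rintegral do rewrite subrr expr0n/=.
    by rewrite mean_cst.
  rewrite leq_eqVlt => /predU1P[->|].
    rewrite subrr mulr0.
    under eq_Rintegral do rewrite subrr expr0n/=.
    by rewrite mean_cst.
  rewrite ltnS => st.
  (* The square is expanded around the last increment: the cross term has mean 0 by [orth], and the
     squared increment is absorbed by [step_sqr_le]. *)
  apply: (@le_trans _ _ (\int[P]_w ((M t w - M s w) ^+ 2 +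
      2 * ((M t w - M s w) * (M t.+1 w - M t w)) + C ^+ 2 * step tau t.+1 ^+ 2))).
    apply: mean_le.
    - exact: bounded_measurable_exp.
    - apply: bounded_measurableD; last exact: bounded_measurable_cst.
      apply: bounded_measurableD; first exact: bounded_measurable_exp.
      apply: bounded_measurableM; first exact: bounded_measurable_cst.
      exact: bounded_measurableM.
    - move=> w.
      have : (M t.+1 w - M t w) ^+ 2 <= C ^+ 2 * step tau t.+1 ^+ 2.
        by rewrite -exprMn -(real_normK (num_real (_ - _))) lerXn2r// nnegrE (le_trans _ (MC t w)).
      nra.
  rewrite mean_add; last 2 first.
  - apply: bounded_measurableD; first exact: bounded_measurable_exp.
    apply: bounded_measurableM; first exact: bounded_measurable_cst.
    exact: bounded_measurableM.
  - exact: bounded_measurable_cst.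
  rewrite mean_add; last 2 first.
  - exact: bounded_measurable_exp.
  - apply: bounded_measurableM; first exact: bounded_measurable_cst.
    exact: bounded_measurableM.
  rewrite mean_mull; last exact: bounded_measurableM.
  rewrite orth// mulr0 addr0 mean_cst.
  have := step_sqr_le tau t t0; have := IH st; have := sqr_ge0 C; nra.
pose D k w := M (k.+1 ^ 3)%N w - M (k ^ 3)%N w.
have bD k : bounded_measurable (D k) by exact: bB.
(* The weight [(k + 1)^2] is large enough for its inverse to be summable, yet small enough for
   [step_cube_gap] to keep the weighted variances summable. *)
have sumD : {ae P, forall w, cvgn (series (fun k => k.+1%:R ^+ 2 * D k w ^+ 2))}.
  apply: (ae_summable (fun k w => k.+1%:R ^+ 2 * D k w ^+ 2)
      (C ^+ 2 * (48 * (1 + tau^-1)) * step 1 0)) => [n w|n|n].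
  - by rewrite mulr_ge0// sqr_ge0.
  - apply: bounded_measurableM; first exact: bounded_measurable_cst.
    exact: bounded_measurable_exp (bD n).
  - apply: (@le_trans _ _ (\sum_(0 <= k < n)
        C ^+ 2 * (48 * (1 + tau^-1)) * step 1 k.+1 ^+ 2)).
      apply: ler_sum_nat => k _.
      rewrite mean_mull; last exact: bounded_measurable_exp (bD k).
      have k3 : (k ^ 3 <= k.+1 ^ 3)%N by rewrite leq_exp2r.
      apply: (@le_trans _ _ (k.+1%:R ^+ 2 *
          (C ^+ 2 * (step tau (k ^ 3) - step tau (k.+1 ^ 3))))).
        by rewrite ler_wpM2l ?sqr_ge0//; exact: var.
      rewrite mulrCA -[leRHS]mulrA ler_wpM2l ?sqr_ge0//.
      exact: step_cube_gap.
    rewrite -mulr_sumr ler_wpM2l ?(series_step_sqr_le 1 n ltr01)//.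
    by rewrite mulr_ge0 ?sqr_ge0// mulr_ge0// addr_ge0// invr_ge0 ltW.
apply: filterS sumD => w cD.
apply: (cvg_along_cubes _ tau C) => //.
apply: summable_increments_cvg.
(* Pathwise, [x <= c x^2 + 1 / (4 c)] with [x = |D|] and [c = (k + 1)^2] replaces Cauchy-Schwarz;
   the last term is at most [4 / (k + 2)^2]. *)
apply: (@series_le_cvg _ _
    ((fun k => k.+1%:R ^+ 2 * D k w ^+ 2) + (fun k => 4 * step 1 k.+1 ^+ 2))) => [n|n|n|].
- exact: normr_ge0.
- by rewrite addr_ge0// mulr_ge0// sqr_ge0.
- rewrite -/(D n w).
  have h : 1 <= n.+1%:R ^+ 2 * (4 * step 1 n.+1 ^+ 2) :> R.
    rewrite /step exprVn mulrA ler_pdivlMr ?exprn_gt0 ?ltr_wpDr//.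
    have : 1 <= n.+1%:R :> R by rewrite ler1n.
    nra.
  have p0 : 0 <= step 1 n.+1 ^+ 2 :> R by exact: sqr_ge0.
  change (`|D n w| <= n.+1%:R ^+ 2 * D n w ^+ 2 + 4 * step 1 n.+1 ^+ 2).
  rewrite -(real_normK (num_real (D n w))).
  move: h p0; move: (n.+1%:R ^+ 2) (step 1 n.+1 ^+ 2) => c p h p0.
  move: (`|D n w|) (normr_ge0 (D n w)) => x x0.
  have c0 : 0 < 4 * c by nra.
  rewrite -(ler_pM2l c0).
  have : 0 <= (2 * c * x - 1) ^+ 2 by exact: sqr_ge0.
  nra.
- apply: (is_cvg_seriesD _ _) => //; apply: cvg_series_mulr.
  exact: cvg_series_step_sqr.
Qed.

End BoundedRandomVariables.

(** * Double counting on a regular graph *)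

Section RegularGraph.
Context {R : realType} {N : nat} (E : rel 'I_N) (d : nat).
Hypothesis regE : regular E d.

Lemma sum_in_nbrs_self (F : 'I_N -> R) :
  \sum_i \sum_(j in in_nbrs E i) F i = d%:R * \sum_i F i.
Proof.
rewrite mulr_sumr; apply: eq_bigr => i _.
by rewrite sumr_const (regE i).1 mulr_natl.
Qed.

(** After exchanging the sums, [F j] is counted once per out-neighbour of [j]. The out-degree enters
    here, the in-degree in [sum_in_nbrs_self]. *)
Lemma sum_in_nbrs (F : 'I_N -> R) :
  \sum_i \sum_(j in in_nbrs E i) F j = d%:R * \sum_i F i.
Proof.
rewrite (exchange_big_dep xpredT)//= mulr_sumr; apply: eq_bigr => j _.
rewrite -(regE j).2 mulr_natl -sumr_const; apply: eq_bigl => i.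
by rewrite !inE.
Qed.

Lemma sum_in_nbrs_le (F : 'I_N -> R) i :
  (forall j, F j <= 1) -> \sum_(j in in_nbrs E i) F j <= d%:R.
Proof.
move=> F1; apply: (@le_trans _ _ (\sum_(j in in_nbrs E i) 1)).
  exact: ler_sum.
by rewrite sumr_const (regE i).1.
Qed.

End RegularGraph.

(** * The process in abstract form: a recursion in [0, 1] whose noise is orthogonal to the past *)

Section ReinforcedProcess.
Context {disp : measure_display} {T : measurableType disp} {R : realType}.
Context (P : probability T R) {N : nat} (E : rel 'I_N) (d : nat) (tau : R).
Variables Z Y : nat -> 'I_N -> T -> R.
Hypotheses (d_gt0 : (0 < d)%N) (regE : regular E d) (tau_gt0 : 0 < tau).
Hypotheses (mZ : forall t i, measurable_fun setT (Z t i))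
           (mY : forall t i, measurable_fun setT (Y t i)).
Hypotheses (Z01 : forall t i w, 0 <= Z t i w <= 1)
           (Y01 : forall t i w, 0 <= Y t i w <= 1).
Hypothesis Z_rec : forall t i w, Z t.+1 i w =
  (1 - step tau t.+1) * Z t i w +
  step tau t.+1 / d%:R * \sum_(j in in_nbrs E i) Y t.+1 j w.
Hypothesis Z_orth : forall s t i j, (s <= t)%N ->
  \int[P]_w (Z s i w * (Y t.+1 j w - Z t j w)) = 0.

Let dR : 0 < d%:R :> R. Proof. by rewrite ltr0n. Qed.

Let bZ t i : bounded_measurable (Z t i).
Proof.
by split => //; exists 1 => w; have /andP[? ?] := Z01 t i w; rewrite ger0_norm.
Qed.

Let bY t i : bounded_measurable (Y t i).
Proof.
by split => //; exists 1 => w; have /andP[? ?] := Y01 t i w; rewrite ger0_norm.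
Qed.

Let bYZ t i : bounded_measurable (fun w => Y t.+1 i w - Z t i w).
Proof. exact: bounded_measurableB. Qed.

Let step0 t : 0 <= step tau t. Proof. exact/ltW/step_gt0. Qed.

(** The increment is the step times the difference of two numbers of [0, 1]: the average draw of the
    in-neighbours and [Z t i w]. *)
Lemma increment_le t i w : `|Z t.+1 i w - Z t i w| <= step tau t.+1.
Proof.
rewrite Z_rec; set G := \sum_(j in _) _.
have G0 : 0 <= G by apply: sumr_ge0 => j _; have /andP[] := Y01 t.+1 j w.
have G1 : G / d%:R <= 1.
  rewrite ler_pdivrMr// mul1r.
  by apply: sum_in_nbrs_le => // j; have /andP[] := Y01 t.+1 j w.
have Gd : 0 <= G / d%:R by rewrite divr_ge0.
have /andP[Z0 Z1] := Z01 t i w.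
rewrite [X in `|X|](_ : _ = step tau t.+1 * (G / d%:R - Z t i w)); last by ring.
rewrite normrM ger0_norm// ler_piMr// ler_norml; lra.
Qed.

(** Each draw reaches [d] urns, so the drift cancels in the total and only centred draws remain. *)
Lemma sum_increment t w : (\sum_i Z t.+1 i w) - (\sum_i Z t i w) =
  step tau t.+1 * \sum_j (Y t.+1 j w - Z t j w).
Proof.
under eq_bigr do rewrite Z_rec.
rewrite big_split/= -!mulr_sumr (sum_in_nbrs _ _ regE) sumrB.
by field; rewrite gt_eqF.
Qed.

Lemma ae_cvg_sum : {ae P, forall w, cvgn (fun t => \sum_i Z t i w)}.
Proof.
apply: (orthogonal_increments_ae_cvg P (fun t w => \sum_i Z t i w) tau N%:R)
  => // [t|t w|s t st].
- exact: bounded_measurable_sum.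
- rewrite -sumrB; apply: le_trans (ler_norm_sum _ _ _) _.
  apply: le_trans (ler_sum _ (fun i _ => increment_le t i w)) _.
  by rewrite sumr_const card_ord mulr_natl.
(* The product of increments splits into pairings of [Z t i] and [Z s i] with centred draws at time
   [t.+1]; [Z_orth] annihilates both kinds. *)
- rewrite (@eq_Rintegral _ _ _ _ setT (fun w => step tau t.+1 *
    \sum_i \sum_j ((Z t i w * (Y t.+1 j w - Z t j w)) -
                   (Z s i w * (Y t.+1 j w - Z t j w))))); last first.
    move=> w _; rewrite sum_increment -sumrB mulrCA; congr (_ * _).
    rewrite mulr_suml; apply: eq_bigr => i _.
    by rewrite mulr_sumr; apply: eq_bigr => j _; rewrite mulrBl.
  have bZYZ u i j : bounded_measurable (fun w => Z u i w * (Y t.+1 j w - Z t j w)).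
    exact: bounded_measurableM.
  have bB i j : bounded_measurable (fun w => Z t i w * (Y t.+1 j w - Z t j w) -
      Z s i w * (Y t.+1 j w - Z t j w)).
    exact: bounded_measurableB.
  rewrite mean_mull; last first.
    by apply: bounded_measurable_sum => i; exact: bounded_measurable_sum.
  rewrite mean_sum; last by move=> i; exact: bounded_measurable_sum.
  rewrite big1 ?mulr0// => i _.
  rewrite mean_sum// big1// => j _.
  by rewrite mean_sub// !Z_orth// subrr.
Qed.

Let energy t w := \sum_i Z t i w ^+ 2.

(** The [Phi] of the overview, each directed edge being counted once. *)
Let dissipation t w := \sum_i \sum_(j in in_nbrs E i) (Z t i w - Z t j w) ^+ 2.

Let noise t w :=
  \sum_i \sum_(j in in_nbrs E i) Z t i w * (Y t.+1 j w - Z t j w).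

Let sqr_diff_le1 t i j w : (Z t i w - Z t j w) ^+ 2 <= 1.
Proof.
have /andP[? ?] := Z01 t i w; have /andP[? ?] := Z01 t j w.
by rewrite -(@real_normK _ (_ - _)) ?num_real// expr_le1// ler_norml; lra.
Qed.

Let dissipation_ge0 t w : 0 <= dissipation t w.
Proof. by apply: sumr_ge0 => i _; apply: sumr_ge0 => j _; exact: sqr_ge0. Qed.

Let dissipation_le t w : dissipation t w <= N%:R * d%:R.
Proof.
rewrite (_ : N%:R * d%:R = \sum_(i < N) d%:R).
  apply: ler_sum => i _.
  exact: (sum_in_nbrs_le _ _ regE (fun j => (Z t i w - Z t j w) ^+ 2)).
by rewrite sumr_const card_ord mulr_natl.
Qed.

(* Expanding the square, the cross term pairs [Z i] with the neighbours [Z j]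
   up to the noise, and [2 Z_i Z_j = Z_i^2 + Z_j^2 - (Z_i - Z_j)^2]; regularity
   (in- and out-degrees) turns the two sums of squares into [2 d * energy]. *)
Lemma energy_decrease t w (a := step tau t.+1) :
  energy t.+1 w <= energy t w - a / d%:R * dissipation t w + 2 * N%:R * a ^+ 2 +
    2 * (a / d%:R) * (1 - a) * noise t w.
Proof.
have a0 : 0 <= a by exact: step0.
have a1 : a <= 1 by exact: step_le1.
pose H i := \sum_(j in in_nbrs E i) Z t j w.
have crossE : \sum_i 2 * (Z t i w * H i) = 2 * d%:R * energy t w - dissipation t w.
  rewrite (_ : 2 * d%:R * energy t w = d%:R * energy t w + d%:R * energy t w).
    rewrite /energy -{1}(sum_in_nbrs_self _ _ regE) -(sum_in_nbrs _ _ regE).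
    rewrite /dissipation -big_split/= -sumrB; apply: eq_bigr => i _.
    rewrite -big_split/= -sumrB /H mulr_sumr mulr_sumr.
    by apply: eq_bigr => j _; ring.
  by ring.
(* The draws are written [Y = Z + (Y - Z)] in the cross term. The only loss is bounding the square
   of the average draw by 1, which produces [a ^+ 2]. *)
have sq i : Z t.+1 i w ^+ 2 <= (1 - a) ^+ 2 * Z t i w ^+ 2 +
    a / d%:R * (1 - a) * (2 * (Z t i w * H i)) +
    2 * (a / d%:R) * (1 - a) *
      (\sum_(j in in_nbrs E i) Z t i w * (Y t.+1 j w - Z t j w)) + a ^+ 2.
  rewrite Z_rec -/a; set G := \sum_(j in _) Y _ _ _.
  have G0 : 0 <= G by apply: sumr_ge0 => j _; have /andP[] := Y01 t.+1 j w.
  have G1 : G / d%:R <= 1.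
    rewrite ler_pdivrMr// mul1r.
    by apply: sum_in_nbrs_le => // j; have /andP[] := Y01 t.+1 j w.
  have -> : \sum_(j in in_nbrs E i) Z t i w * (Y t.+1 j w - Z t j w) =
      Z t i w * (G - H i) by rewrite -mulr_sumr sumrB.
  rewrite -[leLHS]subr0 -subr_ge0.
  rewrite [leRHS](_ : _ = a ^+ 2 * (1 - (G / d%:R) ^+ 2)); last first.
    by field; rewrite gt_eqF.
  rewrite mulr_ge0 ?sqr_ge0// subr_ge0 expr_le1// divr_ge0//.
apply: le_trans (ler_sum _ (fun i _ => sq i)) _.
rewrite !big_split/= -!mulr_sumr -/(energy t w) -/(noise t w).
rewrite mulr_sumr crossE sumr_const card_ord -mulr_natl.
have D1 := dissipation_le t w.
have Dd : dissipation t w / d%:R <= N%:R by rewrite ler_pdivrMr.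
have S0 : 0 <= energy t w by apply: sumr_ge0 => i _; exact: sqr_ge0.
(* One [N] of the constant [2 * N] comes from the [N] terms [a ^+ 2], the other pays for
   [a ^+ 2 * dissipation / d]. *)
rewrite -subr_ge0 [leRHS](_ : _ = a ^+ 2 * (energy t w + (N%:R - dissipation t w / d%:R))); last first.
  by field; rewrite gt_eqF.
by rewrite mulr_ge0 ?sqr_ge0// addr_ge0// subr_ge0.
Qed.

Let b_energy t : bounded_measurable (energy t).
Proof.
by apply: bounded_measurable_sum => i; exact: bounded_measurable_exp.
Qed.

Let b_dissipation t : bounded_measurable (dissipation t).
Proof.
apply: bounded_measurable_sum => i; apply: bounded_measurable_sum => j.
by apply: bounded_measurable_exp; exact: bounded_measurableB.
Qed.

Let b_noise t : bounded_measurable (noise t).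
Proof.
apply: bounded_measurable_sum => i; apply: bounded_measurable_sum => j.
exact: bounded_measurableM.
Qed.

Lemma mean_noise t : \int[P]_w noise t w = 0.
Proof.
have b i j : bounded_measurable (fun w => Z t i w * (Y t.+1 j w - Z t j w)).
  exact: bounded_measurableM.
rewrite mean_sum; last by move=> i; exact: bounded_measurable_sum.
by rewrite big1// => i _; rewrite mean_sum// big1// => j _; exact: Z_orth.
Qed.

Lemma mean_dissipation_le t :
  step tau t.+1 * \int[P]_w dissipation t w <=
  d%:R * (\int[P]_w energy t w - \int[P]_w energy t.+1 w) +
  2 * N%:R * d%:R * step tau t.+1 ^+ 2.
Proof.
set a := step _ _.
have b1 : bounded_measurable (fun w => energy t w - a / d%:R * dissipation t w).
  apply: bounded_measurableB => //; apply: bounded_measurableM => //.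
  exact: bounded_measurable_cst.
have b2 : bounded_measurable (fun w => energy t w - a / d%:R * dissipation t w +
    2 * N%:R * a ^+ 2).
  by apply: bounded_measurableD => //; exact: bounded_measurable_cst.
have b3 c : bounded_measurable (fun w => c * noise t w).
  by apply: bounded_measurableM => //; exact: bounded_measurable_cst.
have : \int[P]_w energy t.+1 w <= \int[P]_w (energy t w -
    a / d%:R * dissipation t w + 2 * N%:R * a ^+ 2 +
    2 * (a / d%:R) * (1 - a) * noise t w).
  apply: mean_le => //; first exact: bounded_measurableD.
  by move=> w; exact: energy_decrease.
rewrite mean_add// mean_mull// mean_noise mulr0 addr0.
rewrite mean_add//; last exact: bounded_measurable_cst.
rewrite mean_cst mean_sub//; last first.
  by apply: bounded_measurableM => //; exact: bounded_measurable_cst.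
rewrite mean_mull//.
set S' := \int[P]_w energy t.+1 w; set S := \int[P]_w energy t w.
set D := \int[P]_w dissipation t w => h.
rewrite -subr_ge0 [leRHS](_ : _ =
  d%:R * (S - a / d%:R * D + 2 * N%:R * a ^+ 2 - S')).
  by rewrite mulr_ge0// ?subr_ge0// ltW.
by field; rewrite gt_eqF.
Qed.

(** Summing [mean_dissipation_le], the energies telescope to at most the initial one, by
    nonnegativity, and the squared steps add up to at most [step tau 0]. *)
Lemma ae_summable_dissipation :
  {ae P, forall w, cvgn (series (fun t => step tau t.+1 * dissipation t w))}.
Proof.
apply: (ae_summable P (fun t w => step tau t.+1 * dissipation t w)
  (d%:R * \int[P]_w energy 0 w + 2 * N%:R * d%:R * step tau 0)) => [t w|t|n].
- exact: mulr_ge0.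
- by apply: bounded_measurableM => //; exact: bounded_measurable_cst.
- apply: (@le_trans _ _ (\sum_(0 <= t < n)
     (d%:R * (\int[P]_w energy t w - \int[P]_w energy t.+1 w) +
      2 * N%:R * d%:R * step tau t.+1 ^+ 2))).
    apply: ler_sum_nat => t _; rewrite mean_mull//.
    exact: mean_dissipation_le.
  rewrite big_split/= -!mulr_sumr; apply: lerD.
    apply: ler_wpM2l => //; rewrite -[leLHS]opprK -sumrN.
    under eq_bigr do rewrite opprB.
    rewrite telescope_sumr// opprB gerBl; apply: Rintegral_ge0 => w _.
    by apply: sumr_ge0 => i _; exact: sqr_ge0.
  by rewrite ler_wpM2l//; exact: series_step_sqr_le.
Qed.

Lemma ae_edge_cvg0 : {ae P, forall w, forall i j, E j i ->
  (Z t i w - Z t j w) @[t --> \oo] --> 0}.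
Proof.
apply: filterS ae_summable_dissipation => w cD i j Eji.
have sq0 : (Z t i w - Z t j w) ^+ 2 @[t --> \oo] --> 0.
  (* Squares are used because the dissipation controls them. The 4 is 2 times 2: the edge difference
     moves by at most two steps, and two such differences add up to at most 2 in absolute value. *)
  apply: (@slowly_varying_cvg0 _ _ (fun t => step tau t.+1) 4) => [t|t|t|||].
  - exact: sqr_ge0.
  - exact: step0.
  - have /andP[? ?] := Z01 t i w; have /andP[? ?] := Z01 t j w.
    have /andP[? ?] := Z01 t.+1 i w; have /andP[? ?] := Z01 t.+1 j w.
    have := increment_le t i w; have := increment_le t j w.
    set a := step _ _; rewrite [_ <= a]ler_norml => /andP[? ?].
    rewrite [_ <= a]ler_norml => /andP[? ?].
    have a0 : 0 <= a by exact: step0.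
    rewrite subr_sqr normrM (_ : 4 * a = (2 * a) * 2); last by ring.
    by apply: ler_pM => //; rewrite ler_norml; lra.
  - apply: (@series_le_cvg _ _ (fun t => step tau t.+1 * dissipation t w)) => // t.
    + by rewrite mulr_ge0// sqr_ge0.
    + exact: mulr_ge0.
    + rewrite ler_wpM2l// /dissipation (bigD1 i)//= (bigD1 j) ?inE//=.
      rewrite -addrA lerDl addr_ge0//.
        by apply: sumr_ge0 => k _; exact: sqr_ge0.
      by apply: sumr_ge0 => k _; apply: sumr_ge0 => l _; exact: sqr_ge0.
  - exact: cvg_series_step_sqr.
  - exact: dvg_series_step.
apply/norm_cvg0P; rewrite (_ : (fun t => _) =
    (fun t => Num.sqrt ((Z t i w - Z t j w) ^+ 2))); last first.
  by apply/funext => t; rewrite sqrtr_sqr.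
rewrite -sqrtr0; apply: (@continuous_cvg _ _ _ _ _
  (fun t => (Z t i w - Z t j w) ^+ 2) (@Num.sqrt R)) sq0.
exact: sqrt_continuous.
Qed.

Lemma ae_consensus : weakly_connected E ->
  {ae P, forall w i, Z t i w @[t --> \oo] -->
     N%:R^-1 * limn (fun t => \sum_j Z t j w)}.
Proof.
move=> conE; apply: filterS2 ae_cvg_sum ae_edge_cvg0 => w cS edge i.
have diff0 j : (Z t i w - Z t j w) @[t --> \oo] --> 0.
  (* Induction along an undirected path with varying start; an edge met against its orientation only
     changes a sign. *)
  have /connectP[p + ->] := conE i j; elim: p i => [|k p IH] i /=.
    by move=> _; under eq_fun do rewrite subrr; exact: cvg_cst.
  move=> /andP[Eik /IH{}IH].
  have -> : (fun t => Z t i w - Z t (last k p) w) =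
      (fun t => (Z t i w - Z t k w) + (Z t k w - Z t (last k p) w)).
    by apply/funext => t; ring.
  rewrite -[X in _ --> X]addr0; apply: cvgD => //.
  case/orP: Eik => [Eik|]; last exact: edge.
  rewrite -[X in _ --> X]oppr0 (_ : (fun t => _) =
      (fun t => - (Z t k w - Z t i w))).
    by apply: cvgN; exact: edge.
  by apply/funext => t; rewrite opprB.
have N0 : N%:R != 0 :> R by rewrite pnatr_eq0 -lt0n (leq_ltn_trans (leq0n i)).
(* Each coordinate is the mean over all vertices plus the mean of its differences to them, which
   vanishes in the limit. *)
have -> : (fun t => Z t i w) = (fun t =>
    N%:R^-1 * (\sum_j Z t j w + \sum_j (Z t i w - Z t j w))).
  apply/funext => t; rewrite -big_split/=.
  under eq_bigr do rewrite addrC subrK.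
  by rewrite sumr_const card_ord -[X in _ * X]mulr_natl mulKf.
apply: cvgM; first exact: cvg_cst.
rewrite -[X in _ --> X]addr0; apply: cvgD; first exact: cS.
rewrite [X in _ --> X](_ : 0 = \sum_(j < N) 0); last by rewrite big1.
apply: cvg_big => [|j _]; [exact: add_continuous|exact: diff0].
Qed.

End ReinforcedProcess.

(** * Ball counts, and events of the history *)

Lemma sum_ltn (n K : nat) : (\sum_(k < K) (k < n)%N)%N = minn K n.
Proof.
elim: K => [|K IH]; first by rewrite big_ord0 min0n.
by rewrite big_ord_recr/= IH; case: (ltnP K n) => /=; lia.
Qed.

Section UrnBasics.
Context {N : nat} (E : rel 'I_N) (d m : nat) (W0 B0 : 'I_N -> nat) (T0 : nat).
Context {T : Type} {R : realType} (Y : nat -> 'I_N -> T -> bool).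
Hypotheses (regE : regular E d) (hA2 : assumption_A2 W0 B0 T0).

Local Notation Z := (white_frac E m W0 B0 R Y).

Lemma total_ballsE t i w : total_balls E m W0 B0 Y t i w = (T0 + m * d * t)%N.
Proof.
rewrite /total_balls; elim: t => [|t IH] /=; first by rewrite hA2.2 muln0 addn0.
rewrite addnACA IH -mulnDr -big_split/=.
(* Whatever its colour, each draw adds [m] balls in total to every out-neighbour. *)
rewrite (eq_bigr (fun=> 1%N)); last by move=> j _; case: (Y _ _ _).
by rewrite sum1_card (regE i).1; lia.
Qed.

Let total_gt0 t : 0 < (T0 + m * d * t)%:R :> R.
Proof. by rewrite ltr0n ltn_addr// (leq_trans _ hA2.1). Qed.

Lemma white_le_total t i w :
  (white E m W0 Y t i w <= T0 + m * d * t)%N.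
Proof. by rewrite -(total_ballsE t i w) leq_addr. Qed.

Lemma white_frac01 t i w : 0 <= Z t i w <= 1.
Proof.
rewrite /white_frac total_ballsE divr_ge0//= ler_pdivrMr// mul1r ler_nat.
exact: white_le_total.
Qed.

(** Dividing numerator and denominator by [m * d] turns the ratio of ball counts into the normalised
    recursion, with [tau = T0 / (m d)]. *)
Lemma white_frac_rec t i w (d_gt0 : (0 < d)%N) (m_gt0 : (0 < m)%N) (a := step (T0%:R / (m * d)%:R) t.+1) :
  Z t.+1 i w = (1 - a) * Z t i w +
    a / d%:R * \sum_(j in in_nbrs E i) (Y t.+1 j w)%:R.
Proof.
rewrite /a /step /white_frac !total_ballsE /= !natrD !natrM natr_sum -natr1.
have d0 : 0 < d%:R :> R by rewrite ltr0n.
have m0 : 0 < m%:R :> R by rewrite ltr0n.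
have T00 : 0 < T0%:R :> R by rewrite ltr0n hA2.1.
have t0 : 0 <= t%:R :> R by rewrite ler0n.
have md0 : 0 < m%:R * d%:R :> R by rewrite mulr_gt0.
have mdt0 : 0 <= m%:R * d%:R * t%:R :> R by rewrite mulr_ge0// ltW.
by field; rewrite !gt_eqF//; lra.
Qed.

(* Layer-cake decomposition, available because an urn holds finitely many balls;
   it reduces identities linear in [Z] to events of the history. *)
Lemma white_frac_layers t i w : Z t i w =
  \sum_(k < T0 + m * d * t) (T0 + m * d * t)%:R^-1 *
    \1_[set v | (k < white E m W0 Y t i v)%N] w.
Proof.
rewrite -mulr_sumr /white_frac total_ballsE mulrC; congr (_ * _).
under eq_bigr do rewrite indicE -[_ \in _]/(in_mem _ _) mem_setE.
by rewrite -natr_sum sum_ltn (minn_idPr (white_le_total t i w)).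
Qed.

(** As the total is deterministic, a threshold on the ball count is one on the fraction, hence a
    generator of the history. *)
Lemma white_gt_preimage s i k : [set w | (k < white E m W0 Y s i w)%N] =
  Z s i @^-1` `]k%:R / (T0 + m * d * s)%:R, +oo[.
Proof.
apply/seteqP; split => w /=;
  by rewrite in_itv/= andbT /white_frac total_ballsE ltr_pM2r ?invr_gt0// ltr_nat.
Qed.

Lemma history_white s t i k : (s <= t)%N ->
  history E m W0 B0 R Y t [set w | (k < white E m W0 Y s i w)%N].
Proof.
move=> st; apply: sub_sigma_algebra; exists s => //; exists i => //.
exists `]k%:R / (T0 + m * d * s)%:R, +oo[%classic; first exact: measurable_itv.
by rewrite setTI white_gt_preimage.
Qed.

End UrnBasics.

(** * Measurability and orthogonality for the urns *)

Section UrnProcess.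
Context {N : nat} (E : rel 'I_N) (d m : nat) (W0 B0 : 'I_N -> nat) (T0 : nat).
Context {disp : measure_display} {T : measurableType disp} {R : realType}.
Context (P : probability T R) (Y : nat -> 'I_N -> {RV P >-> bool}).
Hypotheses (regE : regular E d) (d_gt0 : (0 < d)%N) (m_gt0 : (0 < m)%N).
Hypotheses (hA2 : assumption_A2 W0 B0 T0) (hY : polya_draws E m W0 B0 Y).

Local Notation Z := (white_frac E m W0 B0 R Y).

Let Y_indic t i : (fun w => (Y t i w)%:R : R) = \1_(Y t i @^-1` [set true]).
Proof.
apply/funext => w; rewrite indicE; congr ((nat_of_bool _)%:R).
by apply/idP/idP => [Yw|/set_mem//]; exact/mem_set.
Qed.

Let measurable_white_draw t i : measurable (Y t i @^-1` [set true]).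
Proof. by rewrite -[X in measurable X]setTI; exact: measurable_funP. Qed.

Lemma measurable_draw t i : measurable_fun setT (fun w => (Y t i w)%:R : R).
Proof. by rewrite Y_indic; exact: measurable_indic. Qed.

Lemma measurable_white_frac t i : measurable_fun setT (Z t i).
Proof.
elim: t i => [|t IH] i.
  rewrite (_ : Z 0 i = fun=> (W0 i)%:R / (W0 i + B0 i)%:R) //.
rewrite (_ : Z t.+1 i = fun w =>
    (1 - step (T0%:R / (m * d)%:R) t.+1) * Z t i w +
    step (T0%:R / (m * d)%:R) t.+1 / d%:R *
      \sum_(j in in_nbrs E i) (Y t.+1 j w)%:R).
  apply: measurable_funD; apply: measurable_funM => //.
  rewrite (_ : (fun w => _) =
    fun w => \sum_(j <- index_enum 'I_N) (j \in in_nbrs E i)%:R * (Y t.+1 j w)%:R).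
    apply: measurable_sum => j; apply: measurable_funM => //.
    exact: measurable_draw.
  apply/funext => w; rewrite big_mkcond/=; apply: eq_bigr => j _.
  by case: (j \in _); rewrite ?mul1r ?mul0r.
by apply/funext => w; exact: white_frac_rec.
Qed.

(** The conditional law of a draw is given on events of the history only, so [Z s i] is cut into
    layers, which are such events when [s <= t]. *)
Lemma white_frac_orth s t i j : (s <= t)%N ->
  \int[P]_w (Z s i w * ((Y t.+1 j w)%:R - Z t j w)) = 0.
Proof.
move=> st.
pose D k := [set w | (k < white E m W0 Y s i w)%N].
have hD k : history E m W0 B0 R Y t (D k).
  exact: (history_white _ _ _ _ _ _ _ regE hA2).
have mD k : measurable (D k).
  rewrite /D (white_gt_preimage (R := R) _ _ _ _ _ _ _ regE hA2) -[X in measurable X]setTI.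
  by apply: measurable_white_frac => //; exact: measurable_itv.
have bD k : @bounded_measurable _ T R \1_(D k).
  split; first exact: measurable_indic.
  by exists 1 => w; rewrite indicE ger0_norm// lern1 leq_b1.
have bZ : bounded_measurable (Z t j).
  split; first exact: measurable_white_frac.
  exists 1 => w.
  by have /andP[? ?] := white_frac01 (R := R) _ _ m _ _ _ Y regE hA2 t j w; rewrite ger0_norm.
have bY : @bounded_measurable _ T R (fun w => (Y t.+1 j w)%:R).
  split; first exact: measurable_draw.
  by exists 1 => w; rewrite ger0_norm// lern1 leq_b1.
have layer k : \int[P]_w (\1_(D k) w * ((Y t.+1 j w)%:R - Z t j w)) = 0.
  under eq_Rintegral do rewrite mulrBr.
  rewrite mean_sub; [|exact: bounded_measurableM..].
  have [_ _ condZ] := (hY t).1 j.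
  apply/eqP; rewrite subr_eq0; apply/eqP; rewrite /Rintegral; congr fine.
  (* Both integrals over the layer equal the probability that the layer occurs and the draw is
     white: one directly, the other by the defining property of [Z t j] as a conditional
     probability. *)
  transitivity (P (D k `&` Y t.+1 j @^-1` [set true])).
    rewrite -[in RHS](setIT (_ `&` _)) -integral_indic//; last exact: measurableI.
    apply: eq_integral => w _; congr EFin.
    by rewrite indicI/= -Y_indic.
  rewrite -condZ// [LHS]integral_mkcond; apply: eq_integral => w _.
  rewrite patchE indicE; case: ifPn => _; first by rewrite mul1r.
  by rewrite mul0r.
under eq_Rintegral.
  move=> w _; rewrite (white_frac_layers _ _ _ _ _ _ _ regE hA2) mulr_suml.
  under eq_bigr do rewrite -mulrA.
  over.
have bL k : bounded_measurable (fun w => \1_(D k) w * ((Y t.+1 j w)%:R - Z t j w)).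
  by apply: bounded_measurableM => //; exact: bounded_measurableB.
rewrite mean_sum => [|k]; last first.
  by apply: bounded_measurableM; [exact: bounded_measurable_cst|exact: bL].
rewrite big1// => k _; rewrite mean_mull; last exact: bL.
by rewrite [X in _ * X]layer mulr0.
Qed.

End UrnProcess.

(** * From coordinates to vectors, and the limit theorem for the urns *)

Lemma cvg_row {R : realType} {N : nat} (x : nat -> 'rV[R]_N) (l : 'rV[R]_N) :
  (forall i, x t ord0 i @[t --> \oo] --> l ord0 i) -> x t @[t --> \oo] --> l.
Proof.
move=> xl; apply/cvg_ballP => e e0.
have : \forall t \near \oo, forall i, ball (l ord0 i) e (x t ord0 i).
  by apply: filter_forall => i; move/cvg_ballP : (xl i); exact.
by apply: filterS => t h; split => // i j; rewrite ord1.
Qed.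

Theorem theorem4p9 (N : nat) (E : rel 'I_N) (d m : nat)
    (W0 B0 : 'I_N -> nat) (T0 : nat)
    (disp : measure_display) (Omega : measurableType disp) (R : realType)
    (P : probability Omega R) (Y : nat -> 'I_N -> {RV P >-> bool})
    (hE : no_isolated_vertex E)
    (hconn : weakly_connected E)
    (hm : (0 < m)%N)
    (hA1 : assumption_A1 R E d)
    (hA2 : assumption_A2 W0 B0 T0)
    (hY : polya_draws E m W0 B0 Y) :
  exists Zinf : {RV P >-> R},
    {ae P, forall w,
      white_frac_vec E m W0 B0 R Y t w @[t --> \oo] -->
        Zinf w *: (const_mx 1 : 'rV[R]_N)}.
Proof.
have [regE _ [[a /eigenvalueP[v _ v0] _] _]] := hA1.
(* The nonzero eigenvector from (A1) provides a vertex; as it is not isolated, [d] is positive. *)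
have [i0 _] : exists i, v ord0 i != 0.
  apply/existsP; rewrite -negb_forall; apply: contra v0 => /forallP v0.
  by apply/eqP/rowP => i; rewrite mxE; exact/eqP.
have d_gt0 : (0 < d)%N.
  have [j /orP[Eij|Eji]] := hE i0.
    by rewrite -(regE i0).2 card_gt0; apply/set0Pn; exists j; rewrite inE.
  by rewrite -(regE i0).1 card_gt0; apply/set0Pn; exists j; rewrite inE.
pose Z := white_frac E m W0 B0 R Y.
have Z01 := white_frac01 E d m W0 B0 T0 Y regE hA2 : forall t i w, 0 <= Z t i w <= 1.
have mZ : forall t i, measurable_fun setT (Z t i).
  exact: (measurable_white_frac E d m W0 B0 T0 P Y regE d_gt0 hm hA2).
(* The upper limit is measurable on the whole space, including where the sum might diverge, and
   agrees with the limit almost surely. *)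
pose zinf w := N%:R^-1 * limn_sup (fun t => \sum_j Z t j w).
have S_bounds t w : 0 <= \sum_j Z t j w <= N%:R.
  rewrite sumr_ge0 => [|j _]; last by have /andP[] := Z01 t j w.
  rewrite -[X in _ <= X%:R](card_ord N) -sum1_card natr_sum ler_sum// => j _.
  by have /andP[] := Z01 t j w.
have mzinf : measurable_fun setT zinf.
  apply: measurable_funM => //; apply: measurable_fun_limn_sup => [w _|w _|t].
  - by exists N%:R => _ [t _ <-]; have /andP[] := S_bounds t w.
  - by exists 0 => _ [t _ <-]; have /andP[] := S_bounds t w.
  - exact: measurable_sum.
exists (mfun_Sub (mem_set mzinf)).
have tau0 : 0 < T0%:R / (m * d)%:R :> R.
  by rewrite divr_gt0// ltr0n ?hA2.1// muln_gt0 hm.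
have Y01 t i w : 0 <= ((Y t i w)%:R : R) <= 1 by rewrite ler0n lern1 leq_b1.
have Z_rec t i w :=
  white_frac_rec E d m W0 B0 T0 (R := R) Y regE hA2 t i w d_gt0 hm.
have cS := ae_cvg_sum P E d _ Z (fun t i w => (Y t i w)%:R) d_gt0 regE tau0 mZ
  (measurable_draw P Y) Z01 Y01
  Z_rec
  (white_frac_orth E d m W0 B0 T0 P Y regE d_gt0 hm hA2 hY).
have cons := ae_consensus P E d _ Z (fun t i w => (Y t i w)%:R) d_gt0 regE tau0 mZ
  (measurable_draw P Y) Z01 Y01
  Z_rec
  (white_frac_orth E d m W0 B0 T0 P Y regE d_gt0 hm hA2 hY) hconn.
apply: filterS2 cS cons => w Sw Zw.
apply: cvg_row => i; rewrite !mxE mulr1 /= /zinf (cvg_limn_supE Sw).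
by under eq_fun do rewrite mxE; exact: Zw.
Qed.
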